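(* For a Borel probability measure $\sigma$ on $Y$, $x\in X$ and $n\in\mathbb N$ put $\Phi_n^\sigma(x)=\log\dfrac{\langle\mathcal L_x^{n+1}\mathbb 1,\sigma\rangle}{\langle\mathcal L_{fx}^{n}\mathbb 1,\sigma\rangle}$. There exist $\tau\in(0,1)$ and $C_1>0$ such that for all $k\in\mathbb N$, all $n,m\ge k$, all $x\in X$ and all Borel probability measures $\sigma_n,\sigma_m$ on $Y$, $$|\Phi_n^{\sigma_n}(x)-\Phi_m^{\sigma_m}(x)|\le C_1\tau^k.$$ Consequently $\Phi(x)=\lim_{n\to\infty}\Phi_n^{\sigma_n}(x)$ exists, is independent of the choice of $(\sigma_n)$, and $|\Phi_n^{\sigma_n}(x)-\Phi(x)|\le C_1\tau^n$.
   Context: Standing setting. $X$ and $Y$ are compact connected Riemannian manifolds, $X\times Y$ has the metric $d((x,y),(x',y'))=d_X(x,x')+d_Y(y,y')$. $F(x,y)=(f(x),g_x(y))$ is a skew product which is a Lipschitz local homeomorphism; $Y_x=\{x\}\times Y$ is identified with $Y$. $f$ is uniformly expanding: there are $\gamma>1$, $\delta_f>0$ with $d_X(fx,fx')\ge\gamma d_X(x,x')$ whenever $d_X(x,x')\le\delta_f$. Every $y$ has exactly $d$ preimages under each $g_x$. There is a continuous function $L(\cdot,\cdot)$ such that each $z$ has a neighbourhood $U_z$ on which $F$ is injective and the inverse of $F|_{U_z}$ is $L(z)$-Lipschitz on $F(U_z)$. There are $L\ge1$ and open $\mathcal A\subset X\times Y$ with: (A1) $L(z)\le L$ on $\mathcal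 A$ and $L(z)<\gamma^{-1}$ off $\mathcal A$; (A2) a finite cover $\mathcal U$ of $X\times Y$ by open sets on which $F$ is injective, with $\mathcal A$ covered by $q<d$ elements of $\mathcal U$ and each element of $\mathcal U$ meeting at most one curve of $F^{-1}(c)$ for every distance-minimizing geodesic $c$. The potential $\varphi$ is $\alpha$-Hölder ($0<\alpha<1$) satisfying (P): $\sup\varphi-\inf\varphi<\varepsilon_\varphi$ and $|e^\varphi|_\alpha<\varepsilon_\varphi e^{\inf\varphi}$, where $\varepsilon_\varphi>0$ satisfies $s:=e^{\varepsilon_\varphi}\frac{(d-q)\gamma^{-\alpha}+qL^\alpha}{d}<1$ and $s+2s\varepsilon_\varphi\,\mathrm{diam}(Y)^\alpha<1$. Fiberwise operators: $\mathcal L_x\colon C(Y_x)\to C(Y_{fx})$, $\mathcal L_x\psi(y)=\sum_{\bar y\in g_x^{-1}(y)}e^{\varphi(x,\bar y)}\psi(\bar y)$, $\mathcal L_x^n=\mathcal L_{f^{n-1}x}\circ\cdots\circ\mathcal L_x$; $\langle\psi,\sigma\rangle=\int\psi\,d\sigma$; $\mathbb 1$ is the constant function 1. *)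

(* Defs.v *)
From HB Require Import structures.
From mathcomp Require Import all_boot all_order all_algebra.
From mathcomp Require Import all_classical all_reals all_analysis.
Set Implicit Arguments. Unset Strict Implicit. Unset Printing Implicit Defensive.
Import Order.TTheory GRing.Theory Num.Theory.
Import numFieldNormedType.Exports.
Local Open Scope classical_set_scope.
Local Open Scope ring_scope.

Section Defs.
Context {R : realType}.

Definition is_metric_of (T : pseudoMetricType R) (d : T -> T -> R) :=
  [/\ forall x y, 0 <= d x y,
      forall x y, d x y = 0 <-> x = y,
      forall x y, d x y = d y x,
      forall x y z, d x z <= d x y + d y z &
      forall x (e : R), 0 < e -> ball x e = [set y | d x y < e]].

Definition min_geodesic (T : Type) (d : T -> T -> R) (c : R -> T) :=
  forall s t, 0 <= s <= 1 -> 0 <= t <= 1 ->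
    d (c s) (c t) = `|s - t| * d (c 0) (c 1).

Definition geodesic_space (T : Type) (d : T -> T -> R) :=
  forall a b : T, exists c : R -> T, [/\ min_geodesic d c, c 0 = a & c 1 = b].

Definition dsum (X Y : Type) (dX : X -> X -> R) (dY : Y -> Y -> R)
  (z w : X * Y) : R := dX z.1 w.1 + dY z.2 w.2.

Definition skewF (X Y : Type) (f : X -> X) (g : X -> Y -> Y) (z : X * Y) : X * Y :=
  (f z.1, g z.1 z.2).

Definition inj_on (T U : Type) (A : set T) (h : T -> U) :=
  forall a b, A a -> A b -> h a = h b -> a = b.

Definition lift_of (T : topologicalType) (F : T -> T) (c gam : R -> T) :=
  {within `[0, 1], continuous gam} /\
  forall t, 0 <= t <= 1 -> F (gam t) = c t.

Definition transfer (X : Type) (Y : choiceType) (g : X -> Y -> Y)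
  (phi : X * Y -> R) (x : X) (psi : Y -> R) : Y -> R :=
  fun y => \sum_(yb \in [set yb | g x yb = y]) (expR (phi (x, yb)) * psi yb).

Fixpoint transfer_iter (X : Type) (Y : choiceType) (f : X -> X) (g : X -> Y -> Y)
  (phi : X * Y -> R) (n : nat) (x : X) (psi : Y -> R) : Y -> R :=
  match n with
  | 0 => psi
  | n'.+1 => transfer g phi (iter n' f x) (transfer_iter f g phi n' x psi)
  end.

Definition holder_seminorm (T : Type) (d : T -> T -> R) (alpha : R) (h : T -> R) : R :=
  sup [set r | exists z w, z <> w /\ r = `|h z - h w| / (d z w) `^ alpha].

Definition diam (T : Type) (d : T -> T -> R) : R :=
  sup [set r | exists a b, r = d a b].

End Defs.

Definition borel (T : ptopologicalType) := g_sigma_algebraType (@open T).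

Definition Phi_n {R : realType} (X : Type) (Y : pseudoPMetricType R)
  (f : X -> X) (g : X -> Y -> Y) (phi : X * Y -> R)
  (sigma : probability (borel Y) R) (n : nat) (x : X) : R :=
  ln (Rintegral sigma setT (transfer_iter f g phi n.+1 x (fun _ => 1) : borel Y -> R) /
      Rintegral sigma setT (transfer_iter f g phi n (f x) (fun _ => 1) : borel Y -> R)).

(* Main.v *)
(* Positive functions psi on a fibre with [psi y - psi y' <= k d(y,y')^alpha psi z]
   for all y, y', z form a convex cone. A minimizing geodesic from y to y' lifts
   to d paths joining the preimages of y to those of y'; by (A2) at most q of
   them meet the bad set, so the matched preimages are closer by a factor
   1/gamma except for q pairs, which are at most L times further apart. Hence,
   under (P), for suitable k and lambda < 1, each fibre operator maps the cone of
   parameter k into the cone of parameter lambda k. As in Birkhoff's theorem, the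
   images of [L_x 1] and [1] under the n-th iterate are then enclosed, in the
   order of the cone, between multiples a_n and b_n with [b_n - a_n] decaying
   geometrically. The integral ratio defining Phi_n lies in [a_k, b_k] for every
   n >= k and every measure, and Phi is the logarithm of the common limit. *)
Require Import Defs.
From HB Require Import structures.
From mathcomp Require Import all_boot all_order all_algebra.
From mathcomp Require Import all_classical all_reals all_analysis.
From mathcomp Require Import ring lra.
Set Implicit Arguments. Unset Strict Implicit. Unset Printing Implicit Defensive.
Import Order.TTheory GRing.Theory Num.Theory.
Import numFieldNormedType.Exports.
Local Open Scope classical_set_scope.
Local Open Scope ring_scope.

(** * Metric spaces and compactness *)

Lemma metric_nbhsP (R : realType) (T : pseudoMetricType R) (d : T -> T -> R)
    (x : T) (V : set T) : is_metric_of d ->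
  nbhs x V <-> exists2 e : R, 0 < e & forall y, d x y < e -> V y.
Proof.
case=> _ _ _ _ ballE; split.
  move=> /nbhs_ballP[e /= e0 eV]; exists e => // y dxy; apply: eV.
  by rewrite ballE.
move=> [e e0 eV]; apply/nbhs_ballP; exists e => //= y.
by rewrite ballE//; exact: eV.
Qed.

Lemma open_prod_metric (R : realType) (X Y : pseudoMetricType R)
    (dX : X -> X -> R) (dY : Y -> Y -> R) (V : set (X * Y)) z :
  is_metric_of dX -> is_metric_of dY -> open V -> V z ->
  exists2 e : R, 0 < e & forall w, dsum dX dY z w < e -> V w.
Proof.
move=> mX mY oV Vz; have := open_nbhs_nbhs (conj oV Vz).
move=> /nbhs_ballP[e /= e0 eV]; exists e => // w zw; apply: eV.
case: mX => X0 _ _ _ bX; case: mY => Y0 _ _ _ bY.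
have := X0 z.1 w.1; have := Y0 z.2 w.2; move: zw; rewrite /dsum => zw Y1 X1.
by split; rewrite (bX, bY)//=; lra.
Qed.

(** Compactness in its near-covering form, with the filter of small positive [r] as the parameter: a
    threshold valid near each point becomes one threshold for the whole space. *)
Lemma compact_uniform (R : realType) (T : pseudoMetricType R) (d : T -> T -> R)
    (P : R -> T -> Prop) : is_metric_of d -> compact [set: T] ->
  (forall x, exists2 e : R, 0 < e &
     forall y r, d x y < e -> 0 < r < e -> P r y) ->
  exists2 r : R, 0 < r & forall x, P r x.
Proof.
move=> mT /compact_near_coveringP cT H.
have := cT R 0^'+ P _.
have H1 : forall x, [set: T] x -> \forall x' \near x & i \near 0^'+, P i x'.
  move=> x _; have [e e0 He] := H x.
  exists ([set y | d x y < e], [set r : R | 0 < r < e]) => /=; last first.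
    by move=> [y r] /= [] /He; apply.
  split; first by apply/(metric_nbhsP _ _ mT); exists e.
  near=> r; apply/andP; split; near: r; first exact: nbhs_right_gt.
  exact: nbhs_right_lt.
move=> /(_ _ H1) H2.
near (0:R)^'+ => r.
exists r; first by near: r; exact: nbhs_right_gt.
by move=> x; have : [set: T] `<=` P r; [near: r|exact].
Unshelve. all: by end_near. Qed.

Lemma compact_bounded_metric (R : realType) (T : pseudoMetricType R)
    (d : T -> T -> R) : is_metric_of d -> compact [set: T] ->
  exists D : R, forall a b, d a b <= D.
Proof.
move=> mT cT; have [[x0 _]|nT] := pselect (exists x : T, True); last first.
  by exists 0 => a b; exfalso; apply: nT; exists a.
have [d0 _ dC dT _] := mT.
(* Boundedness is recast as a property of all small [r], namely [d x0 x <= r^-1]. Near [x],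
   distances to [x0] grow by less than 1, which explains the [+ 1] in the threshold. *)
have [r r0 Hr] : exists2 r : R, 0 < r & forall x, d x0 x <= r^-1.
  apply: (compact_uniform mT cT) => x.
  have h0 : 0 < (d x0 x + 1)^-1 by rewrite invr_gt0; have := d0 x0 x; lra.
  exists (Num.min 1 (d x0 x + 1)^-1); first by rewrite lt_min ltr01.
  move=> y r; rewrite !lt_min => /andP[xy _] /andP[r0 /andP[_ rx]].
  have : d x0 x + 1 <= r^-1.
    by rewrite -[leLHS]invrK lef_pV2 ?posrE// ltW.
  have := dT x0 x y; lra.
exists (r^-1 + r^-1) => a b; have := dT a x0 b.
rewrite (dC a x0); have := Hr a; have := Hr b; lra.
Qed.

Lemma diam_ge (R : realType) (T : pseudoMetricType R) (d : T -> T -> R) a b :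
  is_metric_of d -> compact [set: T] -> d a b <= diam d.
Proof.
move=> mT cT; apply: ub_le_sup; last by exists a, b.
have [D HD] := compact_bounded_metric mT cT.
by exists D => _ [u [v ->]].
Qed.

(* The set of [t] where the bound holds on [[0, t]] is closed and open to the right. *)
Lemma local_to_global_lipschitz (R : realType) (T : Type) (d : T -> T -> R)
    (h : R -> T) (L : R) :
  (forall x, d x x = 0) -> (forall x y, d x y = d y x) ->
  (forall x y z, d x z <= d x y + d y z) -> 0 <= L ->
  (forall t, 0 <= t <= 1 -> exists2 e : R, 0 < e &
    forall s, 0 <= s <= 1 -> `|t - s| < e -> d (h t) (h s) <= L * `|t - s|) ->
  d (h 0) (h 1) <= L.
Proof.
move=> d0 dC dT L0 H.
pose S := [set t : R | 0 <= t <= 1 /\ d (h 0) (h t) <= L * t].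
have S0 : S 0 by split; [rewrite lexx ler01|rewrite d0 mulr0].
have supS : has_sup S.
  split; first by exists 0.
  by exists 1 => t [/andP[_ t1] _].
pose s := sup S.
have s0 : 0 <= s by apply: ub_le_sup => //; case: supS.
have s1 : s <= 1 by apply: ge_sup; [exists 0|move=> t [/andP[_ t1] _]].
have s01 : 0 <= s <= 1 by apply/andP.
have [e e0 He] := H s s01.
have Ss : d (h 0) (h s) <= L * s.
  have [t St et] := sup_adherent e0 supS.
  have [/andP[t0 t1] Ht] := St.
  have ts : t <= s by apply: ub_le_sup => //; case: supS.
  have := He t; rewrite t0 t1 => /(_ isT).
  have st0 : 0 <= s - t by lra.
  rewrite (ger0_norm st0) => /(_ _)HH.
  have {}HH : d (h s) (h t) <= L * (s - t) by apply: HH; move: et; rewrite -/s; lra.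
  have := dT (h 0) (h t) (h s); rewrite (dC (h t) (h s)); lra.
have [s_lt1|] := ltP s 1; last first.
  move=> s1'; have sE : s = 1 by apply/le_anti; rewrite s1 s1'.
  by move: Ss; rewrite sE mulr1.
exfalso; pose t := Num.min 1 (s + e / 2).
have [st t1 te] : [/\ s < t, t <= 1 & t - s < e].
  rewrite /t; split.
  - by rewrite lt_min s_lt1 /=; lra.
  - by rewrite ge_min lexx.
  - have : Num.min 1 (s + e / 2) <= s + e / 2 by rewrite ge_min lexx orbT.
    lra.
have t01 : 0 <= t <= 1 by apply/andP; split => //; lra.
have := He t t01; rewrite distrC ger0_norm; last by lra.
move=> /(_ te) Hst.
have : t <= s.
  apply: ub_le_sup; first by case: supS.
  by split => //; have := dT (h 0) (h s) (h t); lra.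
by rewrite leNgt st.
Qed.

(** * Lifting paths *)

Lemma ex_small_invn (R : archiRealFieldType) (a e : R) : 0 <= a -> 0 < e ->
  exists m : nat, a * (m.+1%:R)^-1 < e.
Proof.
move=> a0 e0; exists (Num.truncn (a / e)).
have /andP[_ H] := Num.Theory.truncn_itv (divr_ge0 a0 (ltW e0)).
by rewrite ltr_pdivrMr// mulrC -ltr_pdivrMr.
Qed.

Section Lifting.
Variables (R : realType) (Y : pseudoMetricType R) (d : Y -> Y -> R) (G : Y -> Y).
Variables (L rho delta : R).
Hypothesis md : is_metric_of d.
Hypotheses (L0 : 0 <= L) (rho0 : 0 < rho) (delta0 : 0 < delta).
Hypothesis Ginj : forall u v, G u = G v -> d u v < rho -> u = v.
Hypothesis Gopen : forall u y, d (G u) y < delta ->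
  exists2 v, G v = y & d u v <= L * d (G u) y.

(** Continuity is replaced by a quantitative form: below a uniform scale [eta] the lift moves at
    most [L] times as far as [c]. *)
Definition lipschitz_lift (c h : R -> Y) :=
  (forall t : R, 0 <= t <= 1 -> G (h t) = c t) /\
  exists2 eta : R, 0 < eta & forall s t : R, 0 <= s <= 1 -> 0 <= t <= 1 ->
    `|s - t| < eta -> d (h s) (h t) <= L * d (c s) (c t).

Variables (c : R -> Y) (l : R).
Hypothesis (l0 : 0 <= l).
Hypothesis cl : forall s t : R, 0 <= s <= 1 -> 0 <= t <= 1 ->
  d (c s) (c t) <= l * `|s - t|.

(** [Gopen] supplies nearby preimages at a uniform scale, so the lift can be continued from one
    point of a fine grid to the next; [Ginj] makes nearby preimages of one point coincide, so the
    pieces fit together. *)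
Lemma lift_exists u : G u = c 0 -> exists2 h, h 0 = u & lipschitz_lift c h.
Proof.
have [L_ge0 rho_gt0] := (L0, rho0); move=> Gu; have [d0 d00 dC dT _] := md.
(* At scale [eps] every selected preimage moves by at most [rho / 5]; the comparison closing the
   proof chains four such moves and has to stay below [rho]. *)
have [eps [eps0 epsd epsL]] : exists eps : R,
    [/\ 0 < eps, eps <= delta & L * eps <= rho / 5].
  have L1 : 0 < 5 * (L + 1) by apply: mulr_gt0 => //; apply: ltr_wpDl.
  exists (Num.min delta (rho / (5 * (L + 1)))).
  split; [by rewrite lt_min delta0 divr_gt0|by rewrite ge_min lexx|].
  have : Num.min delta (rho / (5 * (L + 1))) <= rho / (5 * (L + 1)).
    by rewrite ge_min lexx orbT.
  have : 0 < Num.min delta (rho / (5 * (L + 1))) by rewrite lt_min delta0 divr_gt0.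
  rewrite ler_pdivlMr//; move: (Num.min _ _) => e; lra.
have [m ml] := ex_small_invn l0 eps0.
set M : R := m.+1%:R in ml.
have M0 : 0 < M by rewrite ltr0n.
have [S HS] : {S : Y * Y -> Y & forall p, d (G p.1) p.2 < eps ->
    G (S p) = p.2 /\ d p.1 (S p) <= L * d (G p.1) p.2}.
  apply: (@choice (Y * Y)%type Y (fun p w => d (G p.1) p.2 < eps ->
    G w = p.2 /\ d p.1 w <= L * d (G p.1) p.2)) => -[v y] /=.
  (* When [y] is far from [G v] nothing is required of the selection, and [v] is a placeholder. *)
  have [vy|vy] := ltP (d (G v) y) eps; last by exists v.
  by have [w] := Gopen (lt_le_trans vy epsd); exists w.
have HS5 v y : d (G v) y < eps -> d v (S (v, y)) <= rho / 5.
  move=> vy; have [_ /= /le_trans] := HS (v, y) vy; apply;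
  apply: le_trans epsL; apply: ler_wpM2l => //; exact: ltW.
(* The lift is [h t := S (u_i, c t)] on [[i/M, (i+1)/M]], where the u_i lift the
   grid points and S is the selection of nearby preimages. *)
pose us := fix us k := if k is k'.+1 then S (us k', c (k'.+1%:R / M)) else u.
have itvM k : (k <= m.+1)%N -> 0 <= k%:R / M <= 1.
  move=> km; rewrite divr_ge0 ?ler0n ?(ltW M0)//=.
  by rewrite ler_pdivrMr// mul1r ler_nat.
have step (s t : R) : 0 <= s <= 1 -> 0 <= t <= 1 -> `|s - t| <= M^-1 ->
    d (c s) (c t) < eps.
  move=> hs ht st; apply: le_lt_trans (cl hs ht) _.
  by apply: le_lt_trans ml; exact: ler_wpM2l.
have stepM k : `|k%:R / M - k.+1%:R / M| <= M^-1.
  rewrite -mulrBl -natr1 opprD addrA subrr sub0r normrM normrN normr1 mul1r.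
  by rewrite ger0_norm// invr_ge0 ltW.
have Gus k : (k <= m.+1)%N -> G (us k) = c (k%:R / M).
  elim: k => [|k IH] km; first by rewrite mul0r.
  have [//|/= -> //] := HS (us k, c (k.+1%:R / M)).
  by rewrite /= IH 1?ltnW//; apply: step; rewrite ?itvM// ltnW.
have dus k : (k < m.+1)%N -> d (us k) (us k.+1) <= rho / 5.
  move=> km; apply: HS5; rewrite Gus 1?ltnW//.
  by apply: step; rewrite ?itvM// ltnW.
(* Index of the grid cell containing [t]. At [t = 1] it equals [m.+1], hence the non-strict bound in
   [kP]. *)
pose k_ t : nat := Num.truncn (t * M).
have kP (t : R) : 0 <= t <= 1 -> [/\ (k_ t <= m.+1)%N, (k_ t)%:R <= t * M &
    t * M < (k_ t)%:R + 1].
  move=> /andP[t0 t1].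
  have /andP[h1 h2] := Num.Theory.truncn_itv (mulr_ge0 t0 (ltW M0)).
  split => //; last by rewrite natr1.
  rewrite -(ler_nat R); apply: le_trans h1 _.
  by rewrite -[leRHS]mul1r ler_wpM2r// ltW.
have kc (t : R) : 0 <= t <= 1 -> d (c ((k_ t)%:R / M)) (c t) < eps.
  move=> t01; have [h1 h2 h3] := kP t t01; apply: step => //; first exact: itvM.
  have -> : (k_ t)%:R / M - t = ((k_ t)%:R - t * M) / M.
    by rewrite mulrBl mulfK// gt_eqF.
  rewrite normrM (@ger0_norm _ M^-1) ?invr_ge0 ?(ltW M0)//.
  rewrite -[leRHS]mul1r ler_wpM2r ?invr_ge0 ?(ltW M0)//.
  by rewrite ler_norml; apply/andP; split; lra.
pose h t := S (us (k_ t), c t).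
have Gh (t : R) : 0 <= t <= 1 -> G (h t) = c t.
  move=> t01; have [h1 _ _] := kP t t01.
  by have [|//] := HS (us (k_ t), c t); rewrite /= Gus//; exact: kc.
have dh (t : R) : 0 <= t <= 1 -> d (us (k_ t)) (h t) <= rho / 5.
  by move=> t01; have [h1 _ _] := kP t t01; apply: HS5; rewrite Gus//; exact: kc.
exists h.
  have k0 : k_ 0 = 0%N.
    have [|_ h1 _] := kP 0; first by rewrite lexx ler01.
    by apply/eqP; rewrite -leqn0 -(ler_nat R); move: h1; rewrite mul0r.
  have usk0 : us (k_ 0) = u by rewrite k0.
  have := HS (us (k_ 0), c 0); rewrite -/(h 0) /= usk0 Gu (d00 (c 0) (c 0)).2// mulr0.
  move=> /(_ eps0)[_ h1].
  by apply/esym/d00/le_anti; rewrite h1 d0.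
split => //; exists M^-1; first by rewrite invr_gt0.
move=> s t hs ht st.
have csct := step _ _ hs ht (ltW st).
have [|] := HS (h s, c t); rewrite /= Gh// => Gv dv.
(* The preimage of [c t] selected near [h s] has the required bound by construction. It is [h t] by
   local injectivity, since the grid indices of [s] and [t] differ by at most one. *)
suff <- : S (h s, c t) = h t by [].
apply: Ginj; first by rewrite Gv Gh.
have h5 : d (h s) (S (h s, c t)) <= rho / 5 by apply: HS5; rewrite Gh.
have dk : d (us (k_ s)) (us (k_ t)) <= rho / 5.
  have [s1 s2 s3] := kP s hs; have [t1 t2 t3] := kP t ht.
  have st' : `|s * M - t * M| < 1.
    by rewrite -mulrBl normrM (gtr0_norm M0) -ltr_pdivlMr// mul1r.
  move: st'; rewrite ltr_norml => /andP[st1 st2].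
  have h6 : (k_ s <= (k_ t).+1)%N.
    by rewrite -ltnS -(ltr_nat R) -[X in _ < X]natr1 -natr1; lra.
  have h7 : (k_ t <= (k_ s).+1)%N.
    by rewrite -ltnS -(ltr_nat R) -[X in _ < X]natr1 -natr1; lra.
  have [lt_st|lt_ts|->] := ltngtP (k_ s) (k_ t).
  - have e : k_ t = (k_ s).+1 by apply/anti_leq; rewrite h7 lt_st.
    by rewrite e dus// -e.
  - have e : k_ s = (k_ t).+1 by apply/anti_leq; rewrite h6 lt_ts.
    by rewrite e dC dus// -e.
  - by rewrite (d00 _ _).2// divr_ge0 ?ltW.
have a1 := dh s hs; have a2 := dh t ht.
have a3 := dT (S (h s, c t)) (h s) (h t).
have a4 := dT (h s) (us (k_ s)) (h t).
have a5 := dT (us (k_ s)) (us (k_ t)) (h t).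
rewrite (dC _ (h s)) in a3; rewrite (dC (h s) (us (k_ s))) in a4.
lra.
Qed.

(** Agreement propagates backwards along a grid: over one step both lifts move less than [rho / 2]
    from a common point, so [Ginj] identifies them again. Consequently lifts with distinct starting
    points have distinct end points. *)
Lemma lift_unique_from_end h1 h2 : lipschitz_lift c h1 -> lipschitz_lift c h2 ->
  h1 1 = h2 1 -> h1 0 = h2 0.
Proof.
have [L_ge0 rho_gt0] := (L0, rho0).
move=> [G1 [e1 e10 H1]] [G2 [e2 e20 H2]] h11; have [d0 d00 dC dT _] := md.
have [m1 Hm1] := ex_small_invn (@ler01 R) (e := Num.min e1 e2) ltac:(by rewrite lt_min e10).
have Ll0 : 0 <= L * l by exact: mulr_ge0.
have [m2 Hm2] := ex_small_invn Ll0 (e := rho / 2) ltac:(by rewrite divr_gt0).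
pose m := maxn m1 m2; pose M : R := m.+1%:R.
have M0 : 0 < M by rewrite ltr0n.
have le1 : M^-1 <= (m1.+1%:R)^-1 by rewrite lef_pV2 ?posrE ?ltr0n// ler_nat ltnS leq_maxl.
have le2 : M^-1 <= (m2.+1%:R)^-1 by rewrite lef_pV2 ?posrE ?ltr0n// ler_nat ltnS leq_maxr.
have Me : M^-1 < e1 /\ M^-1 < e2.
  by apply/andP; rewrite -lt_min; apply: le_lt_trans Hm1; rewrite mul1r.
have Ml : L * l * M^-1 < rho / 2 by apply: le_lt_trans Hm2; exact: ler_wpM2l.
have itvM k : (k <= m.+1)%N -> 0 <= 1 - k%:R / M <= 1.
  move=> km; have : 0 <= k%:R / M by rewrite divr_ge0 ?ler0n ?(ltW M0).
  have : k%:R / M <= 1 by rewrite ler_pdivrMr// mul1r ler_nat.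
  by move=> a1 a0; rewrite lerBlDr lerDl a0 subr_ge0 a1.
have main k : (k <= m.+1)%N -> h1 (1 - k%:R / M) = h2 (1 - k%:R / M).
  elim: k => [|k IH] km; first by rewrite mul0r subr0.
  have {}IH := IH (ltnW km).
  have it1 := itvM _ km; have it2 := itvM _ (ltnW km).
  set t := 1 - k.+1%:R / M in it1 *; set s := 1 - k%:R / M in it2 IH.
  have ts : `|t - s| = M^-1.
    have -> : t - s = - M^-1 by rewrite /t /s -natr1; ring.
    by rewrite normrN gtr0_norm// invr_gt0.
  apply: Ginj; first by rewrite G1// G2.
  have c0 : L * d (c t) (c s) <= L * l * M^-1.
    by rewrite -mulrA ler_wpM2l// -ts; exact: cl.
  have c1 := le_lt_trans c0 Ml.
  have := H1 t s it1 it2; rewrite ts => /(_ Me.1)/le_lt_trans-/(_ _ c1) a1.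
  have := H2 t s it1 it2; rewrite ts => /(_ Me.2)/le_lt_trans-/(_ _ c1) a2.
  have := dT (h1 t) (h1 s) (h2 t); rewrite IH (dC (h2 s)) => /le_lt_trans; apply.
  by rewrite (splitr rho); apply: ltrD => //; rewrite -IH.
by have := main _ (leqnn m.+1); rewrite divff ?gt_eqF// subrr.
Qed.

End Lifting.

(** * Matching preimages *)

Definition enumerates (T : Type) (d : nat) (e : 'I_d -> T) (A : set T) :=
  injective e /\ forall t, A t <-> exists i, e i = t.

Lemma ex_enumerates (T : pointedType) (d : nat) (A : set T) :
  (A #= `I_d)%card -> exists e : 'I_d -> T, enumerates e A.
Proof.
move=> Ad; have : ([set: 'I_d] #= A)%card.
  by apply: card_esym; apply: card_eq_trans Ad _; exact: card_II.
move=> /card_set_bijP[e [e1 e2 e3]]; exists e; split.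
  by move=> i j; apply: e2; rewrite inE.
move=> t; split; first by move=> /e3[i _ <-]; exists i.
by case=> i <-; exact: e1.
Qed.

(** Writing [e'] through [e] gives an injective self-map of ['I_d], which is onto by finiteness. *)
Lemma enumerates_inj (T : Type) (d : nat) (e e' : 'I_d -> T) (A : set T) :
  enumerates e A -> injective e' -> (forall i, A (e' i)) -> enumerates e' A.
Proof.
move=> [einj eA] e'inj e'A; split=> // t; split; last by case=> i <-.
have /choice[s es] : forall i, exists j, e j = e' i by move=> i; apply/eA.
have s_inj : injective s by move=> i j sij; apply: e'inj; rewrite -!es sij.
move=> /eA[j <-]; have [s' s's ss'] := injF_bij s_inj.
by exists (s' j); rewrite -es ss'.
Qed.

Lemma fsum_enumerates (R : realType) (T : choiceType) (d : nat) (e : 'I_d -> T)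
    (A : set T) (F : T -> R) : enumerates e A ->
  \sum_(t \in A) F t = \sum_(i < d) F (e i).
Proof.
move=> [einj eA]; rewrite (reindex_fsbig e [set: 'I_d] A); last first.
  split; first by move=> i _; apply/eA; exists i.
    by move=> i j _ _; exact: einj.
  by move=> t /eA[i <-]; exists i.
rewrite [RHS]fsbig_seq ?index_enum_uniq//; apply: eq_fsbigl => /=.
by apply/seteqP; split=> i _ //=; rewrite mem_index_enum.
Qed.

Section Matching.
Variables (R : realType) (X : pseudoMetricType R) (Y : pseudoPMetricType R).
Variables (dX : X -> X -> R) (dY : Y -> Y -> R) (f : X -> X) (g : X -> Y -> Y).
Local Notation F := (skewF f g).
Local Notation dXY := (dsum dX dY).
Variables (gam deltaf : R) (d q : nat) (Lfun : X * Y -> R) (Lc : R).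
Variables (A : set (X * Y)) (N : nat) (U : 'I_N -> set (X * Y)).
Hypotheses (mX : is_metric_of dX) (mY : is_metric_of dY).
Hypothesis cY : compact [set: Y].
Hypothesis gY : geodesic_space dY.
Hypothesis F_lip : exists K : R, forall z w, dXY (F z) (F w) <= K * dXY z w.
Hypothesis F_homeo : forall z, exists V : set (X * Y),
  [/\ open V, V z, inj_on V F, open (F @` V) &
      forall w, V w -> forall e : R, 0 < e -> exists2 del : R, 0 < del &
        forall w', V w' -> dXY (F w) (F w') < del -> dXY w w' < e].
Hypotheses (gam1 : 1 < gam) (deltaf0 : 0 < deltaf).
Hypothesis f_exp : forall x x', dX x x' <= deltaf -> gam * dX x x' <= dX (f x) (f x').
Hypothesis g_deg : forall x y, ([set yb | g x yb = y] #= `I_d)%card.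
Hypothesis F_inv : forall z, exists V : set (X * Y),
  [/\ open V, V z, inj_on V F &
      forall w w', V w -> V w' -> dXY w w' <= Lfun z * dXY (F w) (F w')].
Hypothesis Lc1 : 1 <= Lc.
Hypothesis LA : forall z, A z -> Lfun z <= Lc.
Hypothesis LnA : forall z, ~ A z -> Lfun z < gam^-1.
Hypothesis A_cover : exists J : {set 'I_N}, #|J| = q /\
  A `<=` \bigcup_(j in [set j | j \in J]) U j.
Hypothesis U_lift : forall j (c : R -> X * Y), min_geodesic dXY c ->
  forall c1 c2 : R -> X * Y, lift_of F c c1 -> lift_of F c c2 ->
  (exists2 t, 0 <= t <= 1 & U j (c1 t)) -> (exists2 t, 0 <= t <= 1 & U j (c2 t)) ->
  forall t, 0 <= t <= 1 -> c1 t = c2 t.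

Let gami1 : gam^-1 < 1. Proof. by rewrite invf_lt1// (lt_trans ltr01). Qed.

Let L_le z : Lfun z <= Lc.
Proof.
have [/LA//|/LnA/ltW/le_trans->//] := pselect (A z).
by rewrite (le_trans (ltW gami1)).
Qed.

Let dXx x : dX x x = 0. Proof. by case: mX => _ d0 *; apply/d0. Qed.
Let dYy y : dY y y = 0. Proof. by case: mY => _ d0 *; apply/d0. Qed.

Let dsum_fiber x u v : dXY (x, u) (x, v) = dY u v.
Proof. by rewrite /dsum /= dXx add0r. Qed.

(** Local injectivity of [F] restricts to the fibre, and compactness of [Y] makes the radius
    uniform. *)
Lemma fiber_locally_injective x : exists2 r : R, 0 < r &
  forall u v, g x u = g x v -> dY u v < r -> u = v.
Proof.
have [Y0 _ _ dT _] := mY.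
have [r r0 Hr] : exists2 r : R, 0 < r &
    forall u v, g x u = g x v -> dY u v < r -> u = v.
  apply: (@compact_uniform _ _ _
    (fun r u => forall v, g x u = g x v -> dY u v < r -> u = v) mY cY).
  move=> u0; have [V [oV Vu0 injV _ _]] := F_homeo (x, u0).
  have [e e0 eV] := open_prod_metric mX mY oV Vu0.
  exists (e / 2) => [|u r u0u /andP[r0 re] v guv uv]; first by rewrite divr_gt0.
  suff [] : (x, u) = (x, v) by [].
  apply: injV; last by rewrite /skewF /= guv.
    by apply: eV; rewrite dsum_fiber; lra.
  by apply: eV; rewrite dsum_fiber; have := dT u0 u v; lra.
by exists r.
Qed.

(** Openness of [F] yields a preimage of [(f x, y)] near [(x, u)], a priori in another fibre. Its
    base point has the same image as [x] under [f] and is close to [x], so expansion forces the two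
    to be equal. The bound then comes from the local inverse of [F]. *)
Lemma fiber_uniformly_open x : exists2 r : R, 0 < r &
  forall u y, dY (g x u) y < r ->
    exists2 v, g x v = y & dY u v <= Lc * dY (g x u) y.
Proof.
have [Y0 _ YC dT _] := mY; have [X0 X00 _ _ _] := mX.
have [K HK] := F_lip.
apply: (@compact_uniform _ _ _ (fun r u => forall y, dY (g x u) y < r ->
    exists2 v, g x v = y & dY u v <= Lc * dY (g x u) y) mY cY).
move=> u0; have [V [oV Vu0 _ oFV Vinv]] := F_homeo (x, u0).
have [V' [oV' V'u0 _ V'L]] := F_inv (x, u0).
have [e' e'0 eV'] := open_prod_metric mX mY oV' V'u0.
have [e [e0 ee' ed]] : exists e : R, [/\ 0 < e, e <= e' & e <= deltaf].
  by exists (Num.min e' deltaf); rewrite lt_min e'0 deltaf0 !ge_min !lexx orbT.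
have [d1 d10 Hd1] := Vinv _ Vu0 _ e0.
have FVu0 : (F @` V) (F (x, u0)) by exists (x, u0).
have [d2 d20 Hd2] := open_prod_metric mX mY oFV FVu0.
have [dd [dd0 dd1 dd2]] : exists e : R, [/\ 0 < e, e <= d1 & e <= d2].
  by exists (Num.min d1 d2); rewrite lt_min d10 d20 !ge_min !lexx orbT.
have K1 : 0 < `|K| + 1 by rewrite ltr_wpDl.
have h0 : 0 < dd / (2 * (`|K| + 1)) by rewrite divr_gt0// mulr_gt0.
(* The bound [dd / 2] leaves room for [y] around [g x u], [e] keeps [u] in the domain of the local
   inverse, and the last term, through the Lipschitz constant of [F], keeps [g x u] within [dd / 2]
   of [g x u0]. *)
exists (Num.min (dd / 2) (Num.min e (dd / (2 * (`|K| + 1))))).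
  by rewrite !lt_min e0 h0 divr_gt0.
move=> u r; rewrite !lt_min => /and3P[_ u0u u0u'] /andP[r0 /andP[rdd _]] y guy.
have gu : dY (g x u0) (g x u) < dd / 2.
  have := HK (x, u0) (x, u); rewrite /skewF /= !dsum_fiber => /le_lt_trans; apply.
  apply: (@le_lt_trans _ _ ((`|K| + 1) * dY u0 u)).
    by apply: ler_wpM2r => //; have := ler_norm K; lra.
  by rewrite mulrC -ltr_pdivlMr// -mulrA -invfM.
have gy : dY (g x u0) y < dd by have := dT (g x u0) (g x u) y; lra.
have [[x' v] Vw [fx' gv]] : (F @` V) (f x, y).
  by apply: Hd2; rewrite /skewF dsum_fiber; lra.
have dw : dXY (x, u0) (x', v) < e.
  by apply: Hd1 => //; rewrite /skewF /= fx' gv dsum_fiber; lra.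
have xx' : x = x'.
  have := dw; rewrite /dsum /= => dw'.
  have xd : dX x x' <= deltaf by have := Y0 u0 v; lra.
  have := f_exp xd; rewrite fx' dXx => h; apply/X00/le_anti; rewrite X0 andbT.
  by rewrite -(@pmulr_rle0 _ gam)// (lt_trans ltr01).
subst x'; exists v; first exact: gv.
have V'u : V' (x, u) by apply: eV'; rewrite dsum_fiber; lra.
have V'v : V' (x, v) by apply: eV'; apply: lt_le_trans dw ee'.
have := V'L _ _ V'u V'v; rewrite /skewF /= !dsum_fiber gv => /le_trans; apply.
exact: ler_wpM2r.
Qed.
Lemma preimage_matching x y y' : exists (e e' : 'I_d -> Y) (J : {set 'I_d}),
  [/\ enumerates e [set yb | g x yb = y], enumerates e' [set yb | g x yb = y'],
      (#|J| <= q)%N &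
      forall i, dY (e i) (e' i) <= (if i \in J then Lc else gam^-1) * dY y y'].
Proof.
have [Y0 Y00 YC dT _] := mY.
have [rho rho0 ginj] := fiber_locally_injective x.
have [delta delta0 gopen] := fiber_uniformly_open x.
have Lc0 : 0 <= Lc by rewrite (le_trans ler01).
have [c [cgeo c0 c1]] := gY y y'.
pose l := dY y y'; have l0 : 0 <= l by exact: Y0.
have cl s t : 0 <= s <= 1 -> 0 <= t <= 1 -> dY (c s) (c t) = l * `|s - t|.
  by move=> hs ht; rewrite cgeo// c0 c1 mulrC.
have cl' s t : 0 <= s <= 1 -> 0 <= t <= 1 -> dY (c s) (c t) <= l * `|s - t|.
  by move=> hs ht; rewrite cl.
have t0 : 0 <= (0 : R) <= 1 by rewrite lexx ler01.
have t1 : 0 <= (1 : R) <= 1 by rewrite lexx ler01.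
have [e ee] := ex_enumerates (g_deg x y).
have [einj eA] := ee.
have ge i : g x (e i) = c 0 by rewrite c0; apply/eA; exists i.
have [h h0 hl] : exists2 h : 'I_d -> R -> Y, forall i, h i 0 = e i &
    forall i, lipschitz_lift dY (g x) Lc c (h i).
  have /choice[h Hh] : forall i, exists k, k 0 = e i /\ lipschitz_lift dY (g x) Lc c k.
    move=> i; have [k k0 kl] := lift_exists mY Lc0 rho0 delta0 ginj gopen l0 cl' (ge i).
    by exists k.
  by exists h => i; case: (Hh i).
have gh i t : 0 <= t <= 1 -> g x (h i t) = c t by case: (hl i) => + _; apply.
pose J : {set 'I_d} := [set i | `[< exists2 t : R, 0 <= t <= 1 & A (x, h i t) >]]%SET.
(* This curve stays in one fibre, so it is a minimizing geodesic of the product and (A2) applies to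
   its lifts. *)
pose C t := (f x, c t).
have Cgeo : min_geodesic dXY C by move=> s t hs ht; rewrite !dsum_fiber; exact: cgeo.
have hlip i : exists2 eta, 0 < eta & forall s t, 0 <= s <= 1 -> 0 <= t <= 1 ->
    `|s - t| < eta -> dY (h i s) (h i t) <= Lc * l * `|s - t|.
  have [_ [eta eta0 H]] := hl i; exists eta => // s t hs ht st.
  by rewrite -mulrA -cl//; exact: H.
have hnear i t (V : set (X * Y)) : 0 <= t <= 1 -> open V -> V (x, h i t) ->
    exists2 eta : R, 0 < eta & forall s, 0 <= s <= 1 -> `|t - s| < eta -> V (x, h i s).
  move=> ht oV Vt; have [eps eps0 epsV] := open_prod_metric mX mY oV Vt.
  have [eta eta0 H] := hlip i.
  have Ll : 0 < Lc * l + 1 by rewrite ltr_wpDl// mulr_ge0.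
  exists (Num.min eta (eps / (Lc * l + 1))); first by rewrite lt_min eta0 divr_gt0.
  move=> s hs; rewrite lt_min => /andP[ts1 ts2]; apply: epsV; rewrite dsum_fiber.
  apply: le_lt_trans (H _ _ ht hs ts1) _.
  move: ts2; rewrite ltr_pdivlMr// mulrC; apply: le_lt_trans.
  by rewrite ler_wpM2r// lerDl.
have hlift i : lift_of F C (fun t => (x, h i t)).
  split; last by move=> t ht; rewrite /skewF /= gh.
  apply/subspace_continuousP => t /=; rewrite in_itv /= => ht V.
  rewrite /= nbhsE => -[W [oW Wt] WV].
  have [eta eta0 H] := hnear i t W ht oW Wt.
  apply/nbhs_ballP; exists eta => //= s ts s01; apply: WV; apply: H => //.
have [JU [JUq AJU]] := A_cover.
have Jq : (#|J| <= q)%N.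
  have [->|[i0 i0J]] := set_0Vmem J; first by rewrite cards0.
  have meets i : i \in J -> exists j, j \in JU /\
      exists2 t, 0 <= t <= 1 & U j (x, h i t).
    rewrite inE => /asboolP[t ht At]; have [j /= jJ Uj] := AJU _ At.
    by exists j; split => //; exists t.
  have [j0 _] := meets _ i0J.
  (* Each lift meeting [A] chooses a cover element that it meets. By (A2) two lifts with the same
     choice agree, in particular at time 0, so the choice is injective on [J]; [j0] is a placeholder
     off [J]. *)
  have /choice[s Hs] : forall i, exists j, i \in J -> j \in JU /\
      exists2 t, 0 <= t <= 1 & U j (x, h i t).
    move=> i; have [iJ|iJ] := boolP (i \in J); last by exists j0.
    by have [j Hj] := meets _ iJ; exists j.
  rewrite -JUq -(@card_in_imset _ _ s).
    by apply/subset_leq_card/fintype.subsetP => _ /imsetP[i iJ ->]; case: (Hs i iJ).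
  move=> i j iJ jJ sij; have [_ Ui] := Hs i iJ; have [_ Uj] := Hs j jJ.
  rewrite -sij in Uj.
  have := U_lift Cgeo (hlift i) (hlift j) Ui Uj t0.
  by move=> []; rewrite !h0; exact: einj.
pose e' i := h i 1.
have e'A i : g x (e' i) = y' by rewrite gh.
have e'inj : injective e'.
  move=> i j eij; apply: einj; rewrite -!h0.
  exact: (lift_unique_from_end mY Lc0 rho0 ginj l0 cl' (hl i) (hl j) eij).
have [e1 e1A] := ex_enumerates (g_deg x y').
exists e, e', J; split => //; first exact: (enumerates_inj e1A e'inj e'A).
move=> i; set La := (X in X * _); rewrite -h0.
have La0 : 0 <= La by rewrite /La; case: ifP => // _; rewrite invr_ge0 (le_trans ler01)// ltW.
(* Along the lift the local inverse constant [Lfun] is at most [Lc] everywhere, and below [gam^-1]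
   if the lift avoids [A]. *)
apply: (local_to_global_lipschitz (h := h i)) => //; first exact: mulr_ge0.
move=> t ht; have [V [oV Vt _ VL]] := F_inv (x, h i t).
have [eta eta0 H] := hnear i t V ht oV Vt; exists eta => // s hs ts.
have := VL _ _ Vt (H s hs ts); rewrite /skewF /= !dsum_fiber !gh// => /le_trans; apply.
rewrite cl// -mulrA; apply: ler_wpM2r; first exact: mulr_ge0.
rewrite /La; case: ifPn => // iJ; apply/ltW/LnA => At; move: iJ.
by rewrite inE => /asboolP; apply; exists t.
Qed.
End Matching.

(** * Contraction in a cone of Holder functions *)

Section Cone.
Variables (R : realType) (Y : Type) (rho : Y -> Y -> R) (D : R).
Hypotheses (rho_ge0 : forall y y', 0 <= rho y y').
Hypotheses (rhoC : forall y y', rho y y' = rho y' y).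
Hypotheses (rhoD : forall y y', rho y y' <= D).

(* Stating the bound for every z, rather than with [inf psi], makes the cone the
   solution set of linear inequalities. *)
Definition holder_cone (k : R) (psi : Y -> R) :=
  (forall y, 0 <= psi y) /\
  forall y y' z, psi y - psi y' <= k * rho y y' * psi z.

Lemma holder_cone_harnack k psi y z : 0 <= k -> holder_cone k psi ->
  psi y <= (1 + k * D) * psi z.
Proof.
move=> k0 [p0 pk]; have := pk y z z; rewrite lerBlDr => /le_trans; apply.
rewrite mulrDl mul1r addrC lerD2l ler_wpM2r//.
exact: ler_wpM2l.
Qed.

Lemma holder_cone_le k k' psi : k <= k' -> holder_cone k psi -> holder_cone k' psi.
Proof.
move=> kk' [p0 pk]; split => // y y' z; apply: le_trans (pk y y' z) _.
by rewrite ler_wpM2r// ler_wpM2r.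
Qed.

Variables (k lam : R) (y0 : Y).
Hypotheses (k0 : 0 <= k) (lam0 : 0 <= lam) (lam1 : lam < 1).
Let H := 1 + k * D.
(** The fraction of the enclosing interval gained at each step: [H ^+ 2] comes from two Harnack
    comparisons, one factor 2 from the hypothesis at the base point in [cone_absorb], the other from
    [1 + lam <= 2]. *)
Definition cone_gain := (1 - lam) / (4 * H ^+ 2).

Let H1 : 1 <= H.
Proof. by rewrite lerDl mulr_ge0// (le_trans (rho_ge0 y0 y0)). Qed.

Lemma cone_gain_gt0 : 0 < cone_gain.
Proof. by rewrite divr_gt0 ?subr_gt0// mulr_gt0// exprn_gt0// (lt_le_trans ltr01). Qed.

Lemma cone_gain_lt1 : cone_gain < 1.
Proof.
have H21 : 1 <= H ^+ 2 by rewrite exprn_ege1.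
rewrite ltr_pdivrMr ?mulr_gt0// ?(lt_le_trans ltr01)// mul1r.
have := lam0; move: (H ^+ 2) H21 => h h1; lra.
Qed.

Variable T : (Y -> R) -> Y -> R.
Hypothesis T_linear : forall a b p r,
  T (fun y => a * p y + b * r y) = (fun y => a * T p y + b * T r y).
Hypothesis T_mono : forall p r, (forall y, p y <= r y) -> forall y, T p y <= T r y.
Hypothesis T_cone : forall p, holder_cone k p -> holder_cone (lam * k) (T p).

(** [T p] lies in the narrower cone of parameter [lam * k], and this slack pays for subtracting a
    small multiple of [T w]. The Harnack inequality for [p] and [w] spreads the comparison at [y0]
    to all points. *)
Lemma cone_absorb p w l : 0 <= l -> holder_cone k p -> holder_cone k w ->
  l * w y0 <= 2 * p y0 ->
  holder_cone k (fun y => T p y - cone_gain * l * T w y).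
Proof.
move=> l0 pk wk pw.
have H0 : 0 < H by apply: lt_le_trans H1.
have pwz z : l / (2 * H ^+ 2) * w z <= p z.
  have h1 := holder_cone_harnack z y0 k0 wk.
  have h2 := holder_cone_harnack y0 z k0 pk.
  rewrite -/H in h1 h2.
  rewrite mulrAC ler_pdivrMr ?mulr_gt0 ?exprn_gt0//.
  apply: le_trans (ler_wpM2l l0 h1) _.
  rewrite mulrCA [leRHS](_ : _ = H * (2 * (H * p z))); last by ring.
  apply: ler_wpM2l; first exact: ltW.
  by apply: le_trans pw _; apply: ler_wpM2l.
have Tpw z : 2 * (cone_gain * l * T w z) <= (1 - lam) * T p z.
  (* The null term [0 * w y] puts the multiple of [w] into the two-term form of [T_linear]. *)
  have := @T_mono (fun y => l / (2 * H ^+ 2) * w y + 0 * w y) p _ z.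
  rewrite T_linear mul0r addr0 => Hz.
  have {}Hz : l / (2 * H ^+ 2) * T w z <= T p z.
    by apply: Hz => y; rewrite mul0r addr0.
  have -> : 2 * (cone_gain * l * T w z) = (1 - lam) * (l / (2 * H ^+ 2) * T w z).
    rewrite /cone_gain; field; exact: lt0r_neq0.
  by apply: ler_wpM2l => //; rewrite subr_ge0 ltW.
have [Tp0 Tpk] := T_cone pk; have [Tw0 Twk] := T_cone wk.
have dl0 : 0 <= cone_gain * l by rewrite mulr_ge0// ltW// cone_gain_gt0.
have dTw z : 0 <= cone_gain * l * T w z by rewrite mulr_ge0.
split=> [y|y y' z].
  rewrite subr_ge0; have := Tpw y; have := dTw y; have := Tp0 y.
  have : lam * T p y >= 0 by rewrite mulr_ge0.
  by move: (cone_gain * l * T w y) => X1; lra.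
have h1 := Tpk y y' z.
have := ler_wpM2l dl0 (Twk y' y z); rewrite (rhoC y') mulrBr => h2.
apply: (@le_trans _ _ (lam * k * rho y y' * T p z +
   cone_gain * l * (lam * k * rho y y' * T w z))).
  rewrite [leLHS](_ : _ = (T p y - T p y') +
    (cone_gain * l * T w y' - cone_gain * l * T w y)); last by ring.
  exact: lerD.
rewrite [leLHS](_ : _ = k * rho y y' *
    (lam * T p z + lam * (cone_gain * l * T w z))); last by ring.
apply: ler_wpM2l; first exact: mulr_ge0.
have : lam * (cone_gain * l * T w z) <= cone_gain * l * T w z.
  by rewrite ler_piMl// ltW.
have := Tpw z; move: (cone_gain * l * T w z) => X1; lra.
Qed.

(* Which end point moves inwards depends on which of [u - a w] and [b w - u] is
   larger at the base point. *)
Lemma cone_enclosure_step u w a b : a <= b -> holder_cone k w ->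
  holder_cone k (fun y => u y - a * w y) -> holder_cone k (fun y => b * w y - u y) ->
  exists a' b', [/\ a <= a', b' - a' = (b - a) * (1 - cone_gain),
    holder_cone k (T w), holder_cone k (fun y => T u y - a' * T w y) &
    holder_cone k (fun y => b' * T w y - T u y)].
Proof.
move=> ab wk pk rk.
have g0 := ltW cone_gain_gt0.
have lamk : lam * k <= k by rewrite ler_piMl// ltW.
have l0 : 0 <= b - a by rewrite subr_ge0.
have Tp : T (fun y => u y - a * w y) = fun y => T u y - a * T w y.
  rewrite (_ : (fun y => u y - a * w y) = fun y => 1 * u y + (- a) * w y).
    by rewrite T_linear; apply/funext => y; rewrite mul1r mulNr.
  by apply/funext => y; rewrite mul1r mulNr.
have Tr : T (fun y => b * w y - u y) = fun y => b * T w y - T u y.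
  rewrite (_ : (fun y => b * w y - u y) = fun y => b * w y + (-1) * u y).
    by rewrite T_linear; apply/funext => y; rewrite mulN1r.
  by apply/funext => y; rewrite mulN1r.
have Twk := holder_cone_le lamk (T_cone wk).
have Tpk := holder_cone_le lamk (T_cone pk).
have Trk := holder_cone_le lamk (T_cone rk).
have [h|h] := leP ((b - a) * w y0) (2 * (u y0 - a * w y0)).
  exists (a + cone_gain * (b - a)), b; split => //.
  - by rewrite lerDl mulr_ge0.
  - by ring.
  - have := cone_absorb l0 pk wk h; rewrite Tp.
    by congr holder_cone; apply/funext => y; ring.
  - by rewrite -Tr.
exists a, (b - cone_gain * (b - a)); split => //.
- by ring.
- by rewrite -Tp.
- have h' : (b - a) * w y0 <= 2 * (b * w y0 - u y0) by lra.
  have := cone_absorb l0 rk wk h'; rewrite Tr.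
  by congr holder_cone; apply/funext => y; ring.
Qed.

End Cone.

(** * Transfer operators *)

Section Transfer.
Variables (R : realType) (X : Type) (Y : pointedType) (dY : Y -> Y -> R).
Variables (g : X -> Y -> Y) (gam : R) (d q : nat) (Lc alpha eps m D : R).
Variable phi : X * Y -> R.
Hypothesis dY_ge0 : forall u v, 0 <= dY u v.
Hypotheses (alpha0 : 0 <= alpha) (eps0 : 0 <= eps).
Hypotheses (gam1 : 1 < gam) (Lc1 : 1 <= Lc) (qd : (q < d)%N).
Hypothesis phi_ge : forall z, m <= phi z.
Hypothesis phi_le : forall z, phi z <= m + eps.
Hypothesis expphi_holder : forall x u v,
  `|expR (phi (x, u)) - expR (phi (x, v))| <= eps * expR m * dY u v `^ alpha.
Hypothesis D_ge : forall u v, dY u v `^ alpha <= D.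
Hypothesis matching : forall x y y', exists (e e' : 'I_d -> Y) (J : {set 'I_d}),
  [/\ enumerates e [set yb | g x yb = y], enumerates e' [set yb | g x yb = y'],
      (#|J| <= q)%N &
      forall i, dY (e i) (e' i) <= (if i \in J then Lc else gam^-1) * dY y y'].

Local Notation rho := (fun u v => dY u v `^ alpha).
Local Notation L := (transfer g phi).

Lemma transfer_enum x y (e : 'I_d -> Y) psi : enumerates e [set yb | g x yb = y] ->
  L x psi y = \sum_(i < d) expR (phi (x, e i)) * psi (e i).
Proof. exact: fsum_enumerates. Qed.

Let fiber_enum x y : exists e : 'I_d -> Y, enumerates e [set yb | g x yb = y].
Proof. by have [e [_ [_ [? _ _ _]]]] := matching x y y; exists e. Qed.

Lemma transfer_linear x a b p r :
  L x (fun y => a * p y + b * r y) = fun y => a * L x p y + b * L x r y.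
Proof.
apply/funext => y; have [e ee] := fiber_enum x y.
rewrite !(transfer_enum _ ee) !mulr_sumr -big_split /=.
by apply: eq_bigr => i _; ring.
Qed.

Lemma transfer_mono x p r : (forall y, p y <= r y) -> forall y, L x p y <= L x r y.
Proof.
move=> pr y; have [e ee] := fiber_enum x y; rewrite !(transfer_enum _ ee).
by apply: ler_sum => i _; apply: ler_wpM2l; rewrite ?expR_ge0.
Qed.

Lemma transfer_one_bounds x y :
  d%:R * expR m <= L x (fun=> 1) y <= d%:R * expR (m + eps).
Proof.
have [e ee] := fiber_enum x y; rewrite (transfer_enum _ ee).
have dE (a : R) : d%:R * a = \sum_(i < d) a.
  by rewrite sumr_const card_ord mulr_natl.
by rewrite !dE; apply/andP; split; apply: ler_sum => i _; rewrite mulr1 ler_expR.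
Qed.

(** The average of the factors by which the [alpha]-th powers of the distances of matched preimages
    change, with [q] bad pairs; [expR eps] times it is the [s] of (P). *)
Definition mean_contraction :=
  ((d - q)%N%:R * gam `^ (- alpha) + q%:R * Lc `^ alpha) / d%:R.

Let gam0 : 0 < gam. Proof. exact: lt_trans ltr01 gam1. Qed.
Let Lc0 : 0 <= Lc. Proof. exact: le_trans ler01 Lc1. Qed.

Lemma mean_contraction_ge0 : 0 <= mean_contraction.
Proof.
by rewrite mulr_ge0 ?invr_ge0 ?ler0n// addr_ge0// mulr_ge0 ?powR_ge0.
Qed.

Let weight (J : {set 'I_d}) i := if i \in J then Lc `^ alpha else gam `^ (- alpha).

Let weight_sum (J : {set 'I_d}) : (#|J| <= q)%N ->
  \sum_(i < d) weight J i <= d%:R * mean_contraction.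
Proof.
move=> Jq; have d0 : (0 < d)%N by apply: leq_trans qd.
rewrite /mean_contraction mulrC divfK ?pnatr_eq0 -?lt0n//.
rewrite (bigID (mem J)) /= (eq_bigr (fun=> Lc `^ alpha)); last first.
  by move=> i iJ; rewrite /weight iJ.
rewrite sumr_const [X in _ + X](eq_bigr (fun=> gam `^ (- alpha))); last first.
  by move=> i iJ; rewrite /weight (negbTE iJ).
rewrite sumr_const.
have -> : #|[pred i | i \notin J]| = (d - #|J|)%N.
  have := cardC (mem J); rewrite card_ord => E.
  by rewrite -[LHS](addKn #|J|); congr (_ - _)%N; exact: E.
(* Bad pairs carry the larger weight, so having exactly [q] of them is the worst case. *)
have ga : gam `^ (- alpha) <= Lc `^ alpha.
  apply: (@le_trans _ _ 1).
    by rewrite -(powRr0 gam) ler_powR ?(ltW gam1)// oppr_le0.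
  by rewrite -(powRr0 Lc) ler_powR.
rewrite -!(mulr_natl (_ `^ _)) natrB ?(leq_trans Jq (ltnW qd))// natrB ?(ltnW qd)//.
have : #|J|%:R <= q%:R :> R by rewrite ler_nat.
by move: (gam `^ (- alpha)) (Lc `^ alpha) ga => a b ab jq; nra.
Qed.

(* Each matched term is bounded by every [psi (ez j)], with [ez] enumerating the
   fibre over z; averaging over j compares it with [L psi z]. *)
Lemma transfer_cone x k psi : 0 <= k -> holder_cone rho k psi ->
  holder_cone rho
    (expR eps * mean_contraction * (k + eps * (1 + k * D))) (L x psi).
Proof.
move=> k0 pk; have [psi0 psik] := pk.
have d0 : (0 < d)%N by apply: leq_trans qd.
have d0R : 0 < d%:R :> R by rewrite ltr0n.
split=> [y|y y' z].
  have [e ee] := fiber_enum x y; rewrite (transfer_enum _ ee).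
  by apply: sumr_ge0 => i _; rewrite mulr_ge0 ?expR_ge0.
have [e [e' [J [ee ee' Jq dJ]]]] := matching x y y'.
have [ez eez] := fiber_enum x z.
have D0 : 0 <= D by apply: le_trans (D_ge y y); exact: powR_ge0.
pose B := expR eps * (k + eps * (1 + k * D)).
have B0 : 0 <= B.
  by rewrite mulr_ge0 ?expR_ge0// addr_ge0// mulr_ge0// addr_ge0// mulr_ge0.
have E1 : 1 <= expR eps by rewrite -expR0 ler_expR.
have rhoJ i : dY (e i) (e' i) `^ alpha <= weight J i * dY y y' `^ alpha.
  apply: (@le_trans _ _ (((if i \in J then Lc else gam^-1) * dY y y') `^ alpha)).
    apply: ge0_ler_powR => //; rewrite nnegrE// mulr_ge0//.
    by case: ifP => // _; rewrite invr_ge0 ltW.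
  rewrite powRM//; last by case: ifP => // _; rewrite invr_ge0 ltW.
  rewrite /weight; case: ifP => // _.
  by rewrite -powR_inv1 ?(ltW gam0)// -powRrM mulN1r.
have term i j : expR (phi (x, e i)) * psi (e i) - expR (phi (x, e' i)) * psi (e' i)
    <= weight J i * dY y y' `^ alpha * B * (expR m * psi (ez j)).
  set r := dY (e i) (e' i) `^ alpha.
  have r0 : 0 <= r by exact: powR_ge0.
  set P := psi (ez j); have P0 : 0 <= P by exact: psi0.
  (* The difference of products splits into the variation of [psi], controlled by the cone, and that
     of [expR phi], controlled by its Holder bound and the Harnack inequality. *)
  have h1 : expR (phi (x, e i)) * (psi (e i) - psi (e' i)) <=
      expR (m + eps) * (k * r * P).
    apply: (@le_trans _ _ (expR (phi (x, e i)) * (k * r * P))).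
      by apply: ler_wpM2l; rewrite ?expR_ge0//; exact: psik.
    by apply: ler_wpM2r; rewrite ?ler_expR// !mulr_ge0.
  have h2 : psi (e' i) * (expR (phi (x, e i)) - expR (phi (x, e' i))) <=
      (1 + k * D) * P * (eps * expR m * r).
    apply: (@le_trans _ _ (psi (e' i) * (eps * expR m * r))).
      apply: ler_wpM2l => //; apply: le_trans (ler_norm _) _; exact: expphi_holder.
    apply: ler_wpM2r; first by rewrite !mulr_ge0 ?expR_ge0.
    exact: (holder_cone_harnack (rho := rho)).
  apply: (@le_trans _ _ (r * (B * (expR m * P)))); last first.
    rewrite -mulrA; apply: ler_wpM2r; last exact: rhoJ.
    by rewrite mulr_ge0// mulr_ge0// expR_ge0.
  rewrite [leLHS](_ : _ = expR (phi (x, e i)) * (psi (e i) - psi (e' i)) +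
    psi (e' i) * (expR (phi (x, e i)) - expR (phi (x, e' i)))); last by ring.
  apply: le_trans (lerD h1 h2) _.
  (* Only the first part needs the factor [expR eps]; since it is at least 1, the second part may
     carry it too, giving the common constant [B]. *)
  rewrite expRD [leRHS](_ : _ = expR m * expR eps * (k * r * P) +
    expR eps * ((1 + k * D) * P * (eps * expR m * r))); last by rewrite /B; ring.
  rewrite lerD2l ler_peMl// !mulr_ge0 ?expR_ge0// addr_ge0// mulr_ge0//.
pose W := dY y y' `^ alpha * B.
have W0 : 0 <= W by rewrite mulr_ge0 ?powR_ge0.
have Lz : \sum_(j < d) expR m * psi (ez j) <= L x psi z.
  rewrite (transfer_enum _ eez); apply: ler_sum => j _.
  by apply: ler_wpM2r; rewrite // ler_expR.
have Lz0 : 0 <= L x psi z.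
  by apply: le_trans Lz; apply: sumr_ge0 => j _; rewrite mulr_ge0 ?expR_ge0.
have w0 i : 0 <= weight J i by rewrite /weight; case: ifP; rewrite powR_ge0.
have term' i : d%:R * (expR (phi (x, e i)) * psi (e i) -
    expR (phi (x, e' i)) * psi (e' i)) <= weight J i * (W * L x psi z).
  rewrite mulr_natl -[in leLHS](card_ord d) -sumr_const.
  apply: (@le_trans _ _ (\sum_(j < d) weight J i * W * (expR m * psi (ez j)))).
    by apply: ler_sum => j _; rewrite /W [_ * (_ * B)]mulrA; exact: term.
  by rewrite -mulr_sumr mulrA; apply: ler_wpM2l => //; exact: mulr_ge0.
rewrite -(ler_pM2l d0R) (transfer_enum _ ee) (transfer_enum _ ee') -sumrB mulr_sumr.
apply: (le_trans (ler_sum _ (fun i _ => term' i))).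
rewrite -mulr_suml.
apply: le_trans (ler_wpM2r _ (weight_sum Jq)) _; first exact: mulr_ge0.
by rewrite le_eqVlt; apply/orP; left; apply/eqP; rewrite /W /B; ring.
Qed.

(** * Iterates of the fibre operators and their enclosures *)

Variable f : X -> X.
Local Notation I := (transfer_iter f g phi).

(** Peeling off the first operator instead of the last makes numerator and denominator of the ratio
    images of [L x 1] and [1] under the same iterate over [f x]. *)
Lemma transfer_iterSr n x psi : I n.+1 x psi = I n (f x) (L x psi).
Proof. by elim: n => //= n <-; rewrite -iterSr. Qed.

Lemma transfer_iter_one_ge n x y : (d%:R * expR m) ^+ n <= I n x (fun=> 1) y.
Proof.
elim: n y => [|n IH] y; first by rewrite expr0.
rewrite /=; set c := (_ ^+ n) in IH.
have c0 : 0 <= c by rewrite exprn_ge0// mulr_ge0 ?expR_ge0.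
apply: (@le_trans _ _ (L (iter n f x) (fun=> c * 1 + 0 * 1) y)).
  rewrite (transfer_linear _ c 0 (fun=> 1) (fun=> 1)) mul0r addr0 exprSr.
  by apply: ler_wpM2l => //; case/andP: (transfer_one_bounds (iter n f x) y).
by apply: transfer_mono => z; rewrite mulr1 mul0r addr0.
Qed.

(** Positive operators preserve pointwise inequalities, so constants found at time [n] serve at all
    later times. *)
Lemma transfer_iter_order a b n N x u w : (n <= N)%N ->
  (forall y, a * I n x w y <= b * I n x u y) ->
  forall y, a * I N x w y <= b * I N x u y.
Proof.
move=> /subnK <-; elim: (N - n)%N => //= {}N IH h y.
have := transfer_mono (iter (N + n) f x) (IH h) y.
have E c p : (fun z => c * I (N + n) x p z) = fun z => c * I (N + n) x p z + 0 * 0.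
  by apply/funext => z; rewrite mulr0 addr0.
by rewrite (E a) (E b) !(transfer_linear _ _ 0 _ (fun=> 0)) !mul0r !addr0.
Qed.

Variables (k lam : R).
Hypotheses (k0 : 0 <= k) (lam0 : 0 <= lam) (lam1 : lam < 1).
Hypothesis k_lam : expR eps * mean_contraction * (k + eps * (1 + k * D)) = lam * k.

Let rho_ge0 u v : 0 <= rho u v. Proof. exact: powR_ge0. Qed.

Lemma transfer_iter_cone n x psi : holder_cone rho k psi -> holder_cone rho k (I n x psi).
Proof.
move=> pk; elim: n => //= n IH; apply: (holder_cone_le rho_ge0 (k := lam * k)).
  by rewrite ler_piMl// ltW.
by rewrite -k_lam; exact: transfer_cone.
Qed.

Lemma holder_cone_one : holder_cone rho k (fun=> 1).
Proof. by split=> // y y' z; rewrite subrr mulr1 mulr_ge0. Qed.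

Hypothesis dYC : forall u v, dY u v = dY v u.
Let rhoC u v : rho u v = rho v u. Proof. by rewrite /= dYC. Qed.

Lemma transfer_enclosure x n : exists a b : R,
  [/\ (1 - lam) * (d%:R * expR m) <= a,
      b - a = (2 * (d%:R * expR (m + eps)) - (1 - lam) * (d%:R * expR m)) *
        (1 - cone_gain D k lam) ^+ n,
      holder_cone rho k (fun y => I n (f x) (L x (fun=> 1)) y - a * I n (f x) (fun=> 1) y) &
      holder_cone rho k (fun y => b * I n (f x) (fun=> 1) y - I n (f x) (L x (fun=> 1)) y)].
Proof.
(* Initial enclosure: [L x 1] lies in the cone of parameter [lam * k], so subtracting [1 - lam]
   times its lower bound stays in the cone of parameter [k]; twice its upper bound leaves room for
   the reversed difference. *)
set a0 := (1 - lam) * _; set b0 := 2 * _.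
have d0R : 0 < d%:R :> R by rewrite ltr0n; apply: leq_trans qd.
have dE0 : 0 < d%:R * expR m by rewrite mulr_gt0 ?expR_gt0.
have Lk : holder_cone rho (lam * k) (L x (fun=> 1)).
  by rewrite -k_lam; apply: transfer_cone => //; exact: holder_cone_one.
have [_ Lk2] := Lk.
have g1 : 0 <= 1 - cone_gain D k lam.
  by rewrite subr_ge0 ltW// (cone_gain_lt1 rho_ge0 D_ge point).
have ab0 : a0 <= b0.
  apply: (@le_trans _ _ (d%:R * expR m)).
    by rewrite ler_piMl ?(ltW dE0)//; have := lam0; lra.
  rewrite /b0 mulrCA; apply: ler_wpM2l; first exact: ltW.
  have : expR m <= expR (m + eps) by rewrite ler_expR lerDl.
  have := expR_gt0 (m + eps); lra.
elim: n => [|n [a [b [aa ba pk rk]]]].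
  exists a0, b0; split => //=; first by rewrite expr0 mulr1.
    split=> [y|y y' z]; rewrite mulr1.
      rewrite subr_ge0; have /andP[+ _] := transfer_one_bounds x y.
      apply: le_trans; rewrite ler_piMl ?(ltW dE0)//; have := lam0; lra.
    rewrite [leLHS](_ : _ = L x (fun=> 1) y - L x (fun=> 1) y'); last by ring.
    apply: le_trans (Lk2 y y' z) _.
    rewrite [leLHS](_ : _ = k * rho y y' * (lam * L x (fun=> 1) z)); last by ring.
    apply: ler_wpM2l; first exact: mulr_ge0.
    have /andP[+ _] := transfer_one_bounds x z.
    move=> h; have : a0 <= (1 - lam) * L x (fun=> 1) z.
      by apply: ler_wpM2l => //; rewrite subr_ge0 ltW.
    lra.
  split=> [y|y y' z]; rewrite mulr1.
    rewrite subr_ge0; have /andP[_ h] := transfer_one_bounds x y.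
    apply: le_trans h _; rewrite /b0 ler_peMl ?ler1n// mulr_ge0 ?expR_ge0//.
  rewrite [leLHS](_ : _ = L x (fun=> 1) y' - L x (fun=> 1) y); last by ring.
  apply: le_trans (Lk2 y' y z) _; rewrite (rhoC y').
  rewrite [leLHS](_ : _ = k * rho y y' * (lam * L x (fun=> 1) z)); last by ring.
  apply: ler_wpM2l; first exact: mulr_ge0.
  have /andP[h1 h2] := transfer_one_bounds x z.
  have Lz0 : 0 <= L x (fun=> 1) z by apply: le_trans h1; exact: ltW.
  have : lam * L x (fun=> 1) z <= L x (fun=> 1) z by rewrite ler_piMl// ltW.
  rewrite /b0; lra.
have ab : a <= b.
  by rewrite -subr_ge0 ba mulr_ge0 ?exprn_ge0// subr_ge0.
have wk := transfer_iter_cone n (f x) holder_cone_one.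
have Tc p : holder_cone rho k p -> holder_cone rho (lam * k) (L (iter n f (f x)) p).
  by move=> pk'; rewrite -k_lam; exact: transfer_cone.
have [a' [b' [aa' ba' _ pk' rk']]] := cone_enclosure_step rho_ge0 rhoC D_ge point
  k0 lam0 lam1 (transfer_linear _) (@transfer_mono _) Tc ab wk pk rk.
exists a', b'; split => //; first exact: le_trans aa'.
by rewrite ba' ba exprSr mulrA.
Qed.

End Transfer.

(** * Integrals and logarithms *)

Lemma holder_continuous (R : realType) (Y : pseudoMetricType R) (dY : Y -> Y -> R)
    (alpha K : R) (h : Y -> R) : is_metric_of dY -> 0 < alpha ->
  (forall u v, h u - h v <= K * dY u v `^ alpha) -> continuous h.
Proof.
move=> mY a0 hK y; apply/cvgrPdist_lt => e e0.
have [d0 _ dC _ _] := mY.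
have K1 : 0 < `|K| + 1 by rewrite ltr_wpDl.
have eK : 0 < e / (`|K| + 1) by rewrite divr_gt0.
(* The radius solves [(|K| + 1) r^alpha = e]. *)
apply/(metric_nbhsP _ _ mY); exists ((e / (`|K| + 1)) `^ alpha^-1).
  exact: powR_gt0.
move=> z yz /=.
have yz' : (`|K| + 1) * dY y z `^ alpha < e.
  rewrite mulrC -ltr_pdivlMr//.
  have -> : e / (`|K| + 1) = (e / (`|K| + 1)) `^ alpha^-1 `^ alpha.
    by rewrite -powRrM mulVf ?gt_eqF// powRr1// ltW.
  by apply: gt0_ltr_powR; rewrite ?nnegrE ?powR_ge0.
have KK : K * dY y z `^ alpha <= (`|K| + 1) * dY y z `^ alpha.
  by apply: ler_wpM2r; rewrite ?powR_ge0//; have := ler_norm K; lra.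
have h1 := hK y z; have h2 := hK z y; rewrite (dC z y) in h2.
by rewrite ltr_norml; apply/andP; split; lra.
Qed.

Lemma continuous_borel_measurable (R : realType) (Y : ptopologicalType) (h : Y -> R) :
  continuous h -> measurable_fun [set: borel Y] (h : borel Y -> R).
Proof.
move=> /continuousP ch; apply: (measurability _ (measurable_realfun.RGenOpens.measurableE R)).
move=> _ [_ [a [b ->] <-]]; rewrite setTI.
by apply: sub_sigma_algebra; apply: ch; exact: interval_open.
Qed.

Lemma bounded_integrable (R : realType) (d : measure_display) (T : measurableType d)
    (mu : probability T R) (h : T -> R) (M : R) :
  measurable_fun setT h -> (forall t, 0 <= h t <= M) ->
  mu.-integrable setT (EFin \o h).
Proof.
move=> mh hM; apply: measurable_bounded_integrable => //.
  exact: (le_lt_trans (probability_le1 mu measurableT) (ltry _)).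
exists M; split; first exact: num_real.
move=> N MN t _ /=; have /andP[h0 hM'] := hM t.
by rewrite ger0_norm// (le_trans hM')// ltW.
Qed.

Lemma Rintegral_ratio_bounds (R : realType) (d : measure_display) (T : measurableType d)
    (mu : probability T R) (u w : T -> R) (a b c M : R) : 0 < c ->
  measurable_fun setT u -> measurable_fun setT w ->
  (forall t, 0 <= u t <= M) -> (forall t, c <= w t <= M) ->
  (forall t, a * w t <= u t <= b * w t) ->
  a <= Rintegral mu setT u / Rintegral mu setT w <= b.
Proof.
move=> c0 mu_ mw uM wM uw.
have iu := bounded_integrable mu mu_ uM.
have wM' t : 0 <= w t <= M by have /andP[h1 ->] := wM t; rewrite (le_trans (ltW c0)).
have iw := bounded_integrable mu mw wM'.
have izw r : mu.-integrable setT (EFin \o (fun t => r * w t)).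
  have := integrableZl measurableT r iw; apply: eq_integrable => //.
have w0 : 0 < Rintegral mu setT w.
  apply: (@lt_le_trans _ _ (Rintegral mu setT (fun=> c))).
    by rewrite Rintegral_cst//= probability_setT mulr1.
  apply: le_Rintegral => //.
    by apply: (@bounded_integrable _ _ _ _ _ c) => // t; rewrite lexx (ltW c0).
  by move=> t _; have /andP[] := wM t.
rewrite ler_pdivlMr// ler_pdivrMr// -!RintegralZl//.
by apply/andP; split; apply: le_Rintegral => // t _; have /andP[] := uw t.
Qed.

(** This is [ln (1 + t) <= t] with [t = (s - s') / s']; the fixed lower bound [a0] makes the
    constant the same for all intervals. *)
Lemma ln_interval_dist (R : realType) (a0 a b r r' : R) : 0 < a0 -> a0 <= a ->
  a <= r <= b -> a <= r' <= b -> `|ln r - ln r'| <= (b - a) / a0.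
Proof.
move=> a00 a0a.
have main s s' : a <= s <= b -> a <= s' <= b -> ln s - ln s' <= (b - a) / a0.
  move=> /andP[as_ sb] /andP[as' s'b].
  have a_gt0 : 0 < a by apply: lt_le_trans a0a.
  have s0 : 0 < s by apply: lt_le_trans as_.
  have s'0 : 0 < s' by apply: lt_le_trans as'.
  rewrite -ln_div ?posrE//.
  have -> : s / s' = 1 + (s - s') / s' by rewrite mulrBl divff ?gt_eqF//; ring.
  apply: le_trans (le_ln1Dx _) _.
    by rewrite ltr_pdivlMr// mulN1r; lra.
  apply: (@le_trans _ _ ((b - a) / s')).
    by apply: ler_wpM2r; rewrite ?invr_ge0 ?(ltW s'0)//; lra.
  apply: ler_wpM2l; first lra.
  by rewrite lef_pV2 ?posrE//; lra.
move=> hr hr'; rewrite ler_norml lerNl opprB; apply/andP; split; exact: main.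
Qed.

Lemma holder_bounded (R : realType) (X Y : pseudoMetricType R) (dX : X -> X -> R)
    (dY : Y -> Y -> R) (alpha K : R) (phi : X * Y -> R) :
  is_metric_of dX -> is_metric_of dY -> compact [set: X] -> compact [set: Y] ->
  0 <= alpha -> (forall z w, `|phi z - phi w| <= K * dsum dX dY z w `^ alpha) ->
  exists M : R, forall z w, `|phi z - phi w| <= M.
Proof.
move=> mX mY cX cY a0 phiK.
have [DX HX] := compact_bounded_metric mX cX.
have [DY HY] := compact_bounded_metric mY cY.
have [X0 _ _ _ _] := mX; have [Y0 _ _ _ _] := mY.
exists (`|K| * (DX + DY) `^ alpha) => z w; apply: le_trans (phiK z w) _.
apply: (@le_trans _ _ (`|K| * dsum dX dY z w `^ alpha)).
  by apply: ler_wpM2r; rewrite ?powR_ge0// ler_norm.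
apply: ler_wpM2l => //; apply: ge0_ler_powR; rewrite ?nnegrE// /dsum.
- exact: addr_ge0.
- apply: addr_ge0; first exact: le_trans (X0 z.1 w.1) (HX _ _).
  exact: le_trans (Y0 z.2 w.2) (HY _ _).
- exact: lerD.
Qed.

Lemma expR_dist_le (R : realType) (a b M : R) : a <= M -> b <= M ->
  `|expR a - expR b| <= expR M * `|a - b|.
Proof.
have main (u v : R) : u <= M -> expR u - expR v <= expR M * `|u - v|.
  move=> uM; apply: (@le_trans _ _ (expR u * (u - v))).
    have := ler_wpM2l (expR_ge0 u) (expR_ge1Dx (v - u)).
    by rewrite -expRD subrKC; move: (expR u) (expR v) => U V; lra.
  apply: (@le_trans _ _ (expR u * `|u - v|)).
    by apply: ler_wpM2l; rewrite ?expR_ge0 ?ler_norm.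
  by apply: ler_wpM2r; rewrite ?ler_expR.
move=> aM bM; rewrite ler_norml lerNl opprB; apply/andP; split; last exact: main.
by rewrite distrC; exact: main.
Qed.

(** The a priori constant [C] bounds the set of quotients, so that its [sup] is a genuine upper
    bound. *)
Lemma holder_seminorm_le (R : realType) (T : Type) (d : T -> T -> R) (alpha C B : R)
    (h : T -> R) : (forall z w, 0 <= d z w) -> (forall z w, d z w = 0 -> z = w) ->
  (forall z w, `|h z - h w| <= C * d z w `^ alpha) ->
  0 <= B -> holder_seminorm d alpha h <= B ->
  forall z w, `|h z - h w| <= B * d z w `^ alpha.
Proof.
move=> d0 d00 hC B0 hB z w; have [->|zw] := pselect (z = w).
  by rewrite subrr normr0 mulr_ge0// powR_ge0.
have pd z' w' : z' <> w' -> 0 < d z' w' `^ alpha.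
  move=> zw'; apply: powR_gt0; rewrite lt_neqAle d0 andbT eq_sym.
  by apply/eqP => /d00.
rewrite -ler_pdivrMr; last exact: pd.
apply: le_trans hB; apply: ub_le_sup; last by exists z, w.
by exists C => _ [u [v [uv ->]]]; rewrite ler_pdivrMr; [exact: hC|exact: pd].
Qed.

(** * Choice of the constants and passage to the limit *)

Theorem theorem3p4 (R : realType)
  (X : pseudoMetricType R) (Y : pseudoPMetricType R)
  (dX : X -> X -> R) (dY : Y -> Y -> R)
  (f : X -> X) (g : X -> Y -> Y)
  (gam deltaf : R) (d q : nat) (Lfun : X * Y -> R) (Lc : R) (A : set (X * Y))
  (N : nat) (U : 'I_N -> set (X * Y))
  (alpha epsphi : R) (phi : X * Y -> R) :
  (* X, Y compact connected, with metrics dX, dY (geodesic spaces) *)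
  is_metric_of dX -> is_metric_of dY ->
  compact [set: X] -> connected [set: X] -> geodesic_space dX ->
  compact [set: Y] -> connected [set: Y] -> geodesic_space dY ->
  (* F is Lipschitz for the sum metric *)
  (exists K : R, forall z w, dsum dX dY (skewF f g z) (skewF f g w) <= K * dsum dX dY z w) ->
  (* F is a local homeomorphism *)
  (forall z, exists V : set (X * Y),
     [/\ open V, V z, inj_on V (skewF f g), open (skewF f g @` V) &
      forall w, V w -> forall e : R, 0 < e -> exists2 del : R, 0 < del &
        forall w', V w' -> dsum dX dY (skewF f g w) (skewF f g w') < del ->
          dsum dX dY w w' < e]) ->
  (* f uniformly expanding *)
  1 < gam -> 0 < deltaf ->
  (forall x x', dX x x' <= deltaf -> gam * dX x x' <= dX (f x) (f x')) ->
  (* every y has exactly d preimages under each g_x *)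
  (forall x y, ([set yb | g x yb = y] #= `I_d)%card) ->
  (* the continuous function L(.) of local inverse Lipschitz constants *)
  continuous Lfun ->
  (forall z, exists V : set (X * Y),
     [/\ open V, V z, inj_on V (skewF f g) &
      forall w w', V w -> V w' ->
        dsum dX dY w w' <= Lfun z * dsum dX dY (skewF f g w) (skewF f g w')]) ->
  (* (A1) *)
  1 <= Lc -> open A ->
  (forall z, A z -> Lfun z <= Lc) ->
  (forall z, ~ A z -> Lfun z < gam^-1) ->
  (* (A2) *)
  (forall j, open (U j)) -> (forall j, inj_on (U j) (skewF f g)) ->
  (forall z, exists j, U j z) ->
  (exists J : {set 'I_N}, #|J| = q /\ A `<=` \bigcup_(j in [set j | j \in J]) U j) ->
  (q < d)%N ->
  (forall j (c : R -> X * Y), min_geodesic (dsum dX dY) c ->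
     forall c1 c2 : R -> X * Y, lift_of (skewF f g) c c1 -> lift_of (skewF f g) c c2 ->
     (exists2 t, 0 <= t <= 1 & U j (c1 t)) -> (exists2 t, 0 <= t <= 1 & U j (c2 t)) ->
     forall t, 0 <= t <= 1 -> c1 t = c2 t) ->
  (* the potential: alpha-Hoelder, 0 < alpha < 1 *)
  0 < alpha < 1 ->
  (exists K : R, forall z w, `|phi z - phi w| <= K * (dsum dX dY z w) `^ alpha) ->
  (* epsilon_phi and condition (P) *)
  0 < epsphi ->
  (let s := expR epsphi *
       (((d - q)%N%:R * gam `^ (- alpha) + q%:R * Lc `^ alpha) / d%:R) in
   s < 1 /\ s + 2 * s * epsphi * (diam dY) `^ alpha < 1) ->
  sup (range phi) - inf (range phi) < epsphi ->
  holder_seminorm (dsum dX dY) alpha (fun z => expR (phi z)) <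
    epsphi * expR (inf (range phi)) ->
  (* conclusion *)
  exists tau C1 : R, [/\ 0 < tau < 1, 0 < C1,
    (forall (k n m : nat), (k <= n)%N -> (k <= m)%N -> forall (x : X)
       (sn sm : probability (borel Y) R),
       `|Phi_n f g phi sn n x - Phi_n f g phi sm m x| <= C1 * tau ^+ k) &
    exists Phi : X -> R, forall (sig : nat -> probability (borel Y) R) (x : X),
      (fun n => Phi_n f g phi (sig n) n x) @ \oo --> Phi x /\
      (forall n, `|Phi_n f g phi (sig n) n x - Phi x| <= C1 * tau ^+ n)].
Proof.
move=> mX mY cX _ gX cY _ gY Flip Fhomeo gam1 df0 fexp gdeg _ Finv Lc1 _ LA LnA _ _ _
  Acov qd Ulift /andP[al0 al1] [K phiK] eps0 [s1 s2] osc hol.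
have [[x0 _]|nX] := pselect (exists x : X, True); last first.
  exists (1 / 2), 1; split => //; first by apply/andP; split; lra.
    by move=> k n m _ _ x; exfalso; apply: nX; exists x.
  by exists (fun=> 0) => sig x; exfalso; apply: nX; exists x.
have matching := preimage_matching mX mY cY gY Flip Fhomeo gam1 df0 fexp gdeg Finv
  Lc1 LA LnA Acov Ulift.
have [X0 X00 _ _ _] := mX; have [Y0 Y00 YC _ _] := mY.
pose z0 : X * Y := (x0, point).
(* Boundedness of [phi] makes [sup] and [inf] of its range genuine bounds. *)
have [M HM] := holder_bounded mX mY cX cY (ltW al0) phiK.
have phiM z : phi z0 - M <= phi z <= phi z0 + M.
  have := HM z z0; rewrite ler_norml => /andP[h1 h2].
  by apply/andP; split; lra.
set m := inf (range phi) in osc hol.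
have phi_ge z : m <= phi z.
  apply: ge_inf; last by exists z.
  by exists (phi z0 - M) => _ [w _ <-]; have /andP[] := phiM w.
have phi_le z : phi z <= m + epsphi.
  have : phi z <= sup (range phi).
    apply: ub_le_sup; last by exists z.
    by exists (phi z0 + M) => _ [w _ <-]; have /andP[] := phiM w.
  lra.
have dsum0 z w : 0 <= dsum dX dY z w by exact: addr_ge0.
have dsum00 z w : dsum dX dY z w = 0 -> z = w.
  case: z w => [a b] [a' b']; rewrite /dsum /= => h.
  have ha := X0 a a'; have hb := Y0 b b'.
  have /X00 -> : dX a a' = 0 by lra.
  by have /Y00 -> : dY b b' = 0 by lra.
have expphi z w : `|expR (phi z) - expR (phi w)| <=
    epsphi * expR m * dsum dX dY z w `^ alpha.
  apply: (@holder_seminorm_le _ _ _ _ (expR (m + epsphi) * K) _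
    (fun z => expR (phi z)) dsum0 dsum00 _ _ (ltW hol)) => [{}z {}w|].
    apply: le_trans (expR_dist_le (phi_le z) (phi_le w)) _.
    by rewrite -mulrA; apply: ler_wpM2l; rewrite ?expR_ge0.
  by rewrite mulr_ge0 ?expR_ge0// ltW.
have expphi_holder x u v : `|expR (phi (x, u)) - expR (phi (x, v))| <=
    epsphi * expR m * dY u v `^ alpha.
  by apply: le_trans (expphi _ _) _; rewrite /dsum /= (X00 x x).2// add0r.
set D := diam dY `^ alpha in s2.
have D_ge u v : dY u v `^ alpha <= D.
  have uv := diam_ge u v mY cY.
  by apply: ge0_ler_powR; rewrite ?nnegrE ?(ltW al0)// (le_trans _ uv).
have D0 : 0 <= D by exact: powR_ge0.
rewrite -/(mean_contraction gam d q Lc alpha) in s1 s2.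
set s := expR epsphi * mean_contraction gam d q Lc alpha in s1 s2.
have s0 : 0 <= s by rewrite mulr_ge0 ?expR_ge0// mean_contraction_ge0.
have seD0 : 0 <= s * epsphi * D := mulr_ge0 (mulr_ge0 s0 (ltW eps0)) D0.
(* The cone estimate sends [k] to [k * th + s * epsphi], and (P) gives [th < 1]. With [lam] midway
   between [th] and 1, requiring this value to be [lam * k] determines [k]. *)
have [th thE] : exists th, th = s + s * epsphi * D by exists (s + s * epsphi * D).
have th1 : th < 1 by rewrite thE; move: s2; rewrite -2!mulrA (mulrA s) => s2; lra.
have th0 : 0 <= th by rewrite thE addr_ge0.
pose lam := (1 + th) / 2.
have lam0 : 0 <= lam by rewrite /lam; lra.
have lam1 : lam < 1 by rewrite /lam; lra.
pose k := 2 * s * epsphi / (1 - th).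
have k0 : 0 <= k.
  apply: divr_ge0; last by rewrite subr_ge0 ltW.
  exact: mulr_ge0 (mulr_ge0 (ler0n _ 2) s0) (ltW eps0).
have k_lam : s * (k + epsphi * (1 + k * D)) = lam * k.
  have -> : s * (k + epsphi * (1 + k * D)) = k * th + s * epsphi by rewrite thE; ring.
  by rewrite /lam /k; field; rewrite subr_eq0 gt_eqF.
have iter_cone n x psi := @transfer_iter_cone _ _ _ _ _ _ _ _ _ _ _ _ _ _ Y0 (ltW al0)
  (ltW eps0) gam1 Lc1 qd phi_ge phi_le expphi_holder D_ge matching f _ _ k0 lam1 k_lam
  n x psi.
have enclosure := transfer_enclosure Y0 (ltW al0) (ltW eps0) gam1 Lc1 qd phi_ge phi_le
  expphi_holder D_ge matching f k0 lam0 lam1 k_lam YC.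
set a0 := (1 - lam) * (d%:R * expR m) in enclosure.
set b0 := 2 * (d%:R * expR (m + epsphi)) in enclosure.
set tau := 1 - cone_gain D k lam in enclosure.
have rho_ge0 u v : 0 <= dY u v `^ alpha by exact: powR_ge0.
have d0R : 0 < d%:R :> R by rewrite ltr0n; apply: leq_trans qd.
have tau01 : 0 < tau < 1.
  rewrite /tau subr_gt0 (cone_gain_lt1 rho_ge0 D_ge point)//= ltrBlDr ltrDl.
  exact: (cone_gain_gt0 rho_ge0 D_ge point).
have a0_gt0 : 0 < a0 by rewrite !mulr_gt0 ?expR_gt0 ?subr_gt0.
have ab0 : a0 < b0.
  rewrite /a0 /b0 mulrCA [ltRHS]mulrCA ltr_pM2l//.
  have : expR m <= expR (m + epsphi) by rewrite ler_expR lerDl ltW.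
  have : (1 - lam) * expR m <= expR m by rewrite ler_piMl ?expR_ge0//; lra.
  have := expR_gt0 (m + epsphi); lra.
pose W n x : Y -> R := transfer_iter f g phi n (f x) (fun=> 1).
pose V n x : Y -> R := transfer_iter f g phi n.+1 x (fun=> 1).
have VE n x : V n x = transfer_iter f g phi n (f x) (transfer g phi x (fun=> 1)).
  exact: transfer_iterSr.
have bounds n x : exists a b, [/\ a0 <= a, b - a = (b0 - a0) * tau ^+ n &
    forall p, (n <= p)%N -> forall y, a * W p x y <= V p x y <= b * W p x y].
  have [a [b [aa ba [pk _] [rk _]]]] := enclosure x n; exists a, b; split=> // p np y.
  rewrite VE; apply/andP; split.
    rewrite -[leRHS]mul1r; apply: (transfer_iter_order matching np) => z.
    by rewrite mul1r -subr_ge0.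
  rewrite -[leLHS]mul1r; apply: (transfer_iter_order matching np) => z.
  by rewrite mul1r -subr_ge0.
have conek_measurable psi : holder_cone (fun u v => dY u v `^ alpha) k psi ->
    measurable_fun [set: borel Y] (psi : borel Y -> R).
  move=> [_ pk]; apply: continuous_borel_measurable.
  apply: (holder_continuous (K := k * psi point) mY al0) => u v.
  by rewrite mulrAC; exact: pk.
have one_k := holder_cone_one dY alpha k0.
have Wk n x : holder_cone (fun u v => dY u v `^ alpha) k (W n x) by exact: iter_cone.
have Vk n x : holder_cone (fun u v => dY u v `^ alpha) k (V n x) by exact: iter_cone.
have ratio (sg : probability (borel Y) R) p x a b :
    (forall y, a * W p x y <= V p x y <= b * W p x y) ->
    a <= Rintegral sg setT (V p x : borel Y -> R) /
      Rintegral sg setT (W p x : borel Y -> R) <= b.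
  move=> abW.
  (* The Harnack inequality bounds both integrands by multiples of their values at [point]. *)
  apply: (@Rintegral_ratio_bounds _ _ _ _ _ _ _ _ ((d%:R * expR m) ^+ p)
    (Num.max ((1 + k * D) * W p x point) ((1 + k * D) * V p x point))).
  - by rewrite exprn_gt0// mulr_gt0// expR_gt0.
  - exact: conek_measurable.
  - exact: conek_measurable.
  - move=> y; rewrite le_max (holder_cone_harnack D_ge _ _ k0 (Vk p x)) orbT andbT.
    by case: (Vk p x).
  - move=> y; rewrite le_max (holder_cone_harnack D_ge _ _ k0 (Wk p x)) andbT.
    exact: transfer_iter_one_ge phi_ge phi_le matching f p (f x) y.
  - exact: abW.
have C1_0 : 0 < (b0 - a0) / a0 by rewrite divr_gt0// subr_gt0.
have tau_n n : ((b0 - a0) / a0) * tau ^+ n = ((b0 - a0) * tau ^+ n) / a0.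
  by rewrite mulrAC.
exists tau, ((b0 - a0) / a0); split => //.
  move=> n N1 N2 nN1 nN2 x sn sm; have [a [b [aa ba ab]]] := bounds n x.
  rewrite tau_n -ba; apply: ln_interval_dist => //.
    exact: ratio (ab _ nN1).
  exact: ratio (ab _ nN2).
(* The supremum of all lower constants lies in every enclosing interval, so it is the limit of the
   ratios whatever the measures. *)
pose S x := [set a : R | exists n, forall y, a * W n x y <= V n x y].
have supS x n a b :
    (forall p, (n <= p)%N -> forall y, a * W p x y <= V p x y <= b * W p x y) ->
    a <= sup (S x) <= b.
  move=> abW.
  have Sa : S x a by exists n => y; have /andP[] := abW n (leqnn n) y.
  have Sb : ubound (S x) b.
    move=> a' [n' Hn'].
    (* A lower constant valid from [n'] and an upper one valid from [n] are compared at the later of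
       the two times, where [W] is positive. *)
    have h1 : a' * W (maxn n n') x point <= V (maxn n n') x point.
      rewrite VE -[leRHS]mul1r; apply: (transfer_iter_order matching (leq_maxr n n')) => z.
      by have := Hn' z; rewrite VE mul1r.
    have /andP[_ h2] := abW _ (leq_maxl n n') point.
    have w0 : 0 < W (maxn n n') x point.
      apply: lt_le_trans (transfer_iter_one_ge phi_ge phi_le matching f _ (f x) point).
      by rewrite exprn_gt0// mulr_gt0// expR_gt0.
    by rewrite -(ler_pM2r w0); exact: le_trans h1 h2.
  apply/andP; split; first by apply: ub_le_sup => //; exists b.
  by apply: ge_sup => //; exists a.
exists (fun x => ln (sup (S x))) => sig x.
have dist n : `|Phi_n f g phi (sig n) n x - ln (sup (S x))| <= (b0 - a0) / a0 * tau ^+ n.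
  have [a [b [aa ba ab]]] := bounds n x.
  rewrite tau_n -ba; apply: ln_interval_dist => //; last exact: supS ab.
  exact: ratio (ab _ (leqnn n)).
split => //.
apply/cvgrPdist_le => e e0.
have [tau_gt0 tau_lt1] := andP tau01.
have : (fun n => (b0 - a0) / a0 * tau ^+ n) @ \oo --> (0 : R).
  by apply: cvg_geometric; rewrite gtr0_norm.
move=> /cvgrPdist_le /(_ e e0); apply: filterS => n.
rewrite sub0r normrN => h; rewrite distrC; apply: le_trans (dist n) _.
exact: le_trans (ler_norm _) h.
Qed.
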